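(* Suppose assumptions (A1)–(A4) stated in the context hold. Let $k,n,p\to\infty$ such that $p/n\to\phi\in(0,\infty)$ and $p/k\to\psi\in[\phi,\infty]$, and let $\mathscr R(\lambda;\phi,\psi)$ denote the deterministic limiting (excess) prediction risk of the full-ensemble ridge estimator, i.e. the limiting generalized risk for $A=\Sigma^{1/2}$, $b=0$, as defined in the context. Then, with the limiting objects $H,G,\rho^2,\sigma^2$ held fixed as $\phi$ varies, the optimal risk of the ridgeless ensemble $$\phi\mapsto\min_{\psi\ge\phi}\mathscr R(0;\phi,\psi)$$ is monotonically increasing in $\phi\in(0,\infty)$ (that is, $0<\phi_1\le\phi_2<\infty$ implies that its value at $\phi_1$ is at most its value at $\phi_2$). Consequently, the optimal risk of the ridge predictor $$\phi\mapsto\min_{\lambda\ge0}\mathscr R(\lambda;\phi,\phi)$$ is also monotonically increasing in $\phi\in(0,\infty)$.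
   Context: Data: $\mathcal D_n=\{(x_i,y_i):i\in[n]\}$ are i.i.d. samples in $\mathbb R^p\times\mathbb R$; $X\in\mathbb R^{n\times p}$ has rows $x_i^\top$, $y\in\mathbb R^n$ has entries $y_i$. Let $\beta_0=\mathbb E[xx^\top]^{-1}\mathbb E[xy]$ and $f_{\mathrm{NL}}(x)=y-x^\top\beta_0$ for $(x,y)$ distributed as $(x_1,y_1)$, and $\|f_{\mathrm{NL}}\|_{L_2}^2=\mathbb E[f_{\mathrm{NL}}(x)^2]$. (A1) Each $y_i$ has mean $0$ and $\mathbb E[|y_i|^{4+\mu}]\le M_\mu<\infty$ for some $\mu>0$ and constant $M_\mu$. (A2) Each $x_i=\Sigma^{1/2}z_i$, where $z_i\in\mathbb R^p$ has i.i.d. entries $z_{ij}$ with mean $0$, variance $1$ and $\mathbb E[|z_{ij}|^{4+\nu}]\le M_\nu<\infty$ for some $\nu>0$ and constant $M_\nu$, and $\Sigma\in\mathbb R^{p\times p}$ is deterministic and symmetric with eigenvalues in $[r_{\min},r_{\max}]$ for constants $0<r_{\min}\le r_{\max}<\infty$. Write $\Sigma=\sum_{j=1}^pr_jw_jw_j^\top$ (eigenvalues $r_j$, orthonormal eigenvectors $w_j$). (A3) There is a deterministic distribution $H$ such that $H_p(r)=p^{-1}\sum_{i=1}^p\mathbf 1\{r_i\le r\}$ converges weakly to $H$. (A4) There is a deterministic distribution $G$ such that $G_p(r)=\|\beta_0\|_2^{-2}\sum_{i=1}^p(\beta_0^\top w_i)^2\mathbf 1\{r_i\le r\}$ converges weakly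 to $G$, and the limits $\rho^2=\lim\|\beta_0\|_2^2$ and $\sigma^2=\lim\|f_{\mathrm{NL}}\|_{L_2}^2$ exist and are finite. Full-ensemble ridge estimator: for $I\subseteq[n]$, $|I|=k$, with $L_I$ the diagonal $0/1$ matrix indicating $I$, $\hat\beta^\lambda_k(\mathcal D_I)=(X^\top L_IX/k+\lambda I_p)^{-1}X^\top L_Iy/k$ for $\lambda>0$ and $(X^\top L_IX/k)^+X^\top L_Iy/k$ for $\lambda=0$; $\hat\beta^\lambda_{k,\infty}=\mathbb E[\hat\beta^\lambda_k(\mathcal D_I)\mid\mathcal D_n]$, $I$ uniform over $k$-element subsets of $[n]$. For $k=n$ this is ordinary ridge on the full data. Limiting risk: $\mathscr R(\lambda;\phi,\psi)$ is the deterministic almost sure limit of $\|\Sigma^{1/2}(\hat\beta^\lambda_{k,\infty}-\beta_0)\|_2^2$, given explicitly by $$\mathscr R(\lambda;\phi,\psi)=\rho^2\,\tilde c(-\lambda;\phi,\psi)+\sigma^2\,\tilde v(-\lambda;\phi,\psi),$$ where, with $v=v(-\lambda;\psi)$ the nonnegative solution of $\frac1v=\lambda+\psi\int\frac{r}{1+vr}\,dH(r)$, $$\tilde v(-\lambda;\phi,\psi)=\frac{\phi\int\frac{r^2}{(1+vr)^2}\,dH(r)}{v^{-2}-\phi\int\frac{r^2}{(1+vr)^2}\,dH(r)},\qquad \tilde c(-\lambda;\phi,\psi)=(1+\tilde v(-\lambda;\phi,\psi))\int\frac{r}{(1+vr)^2}\,dG(r).$$ Values at $\lambda=0$, at $\psi=\infty$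 and at $\lambda=\infty$ are understood as limits (so $v(0;\psi)=\infty$ for $\psi\le1$, and $v=0$ if $\psi=\infty$ or $\lambda=\infty$), with values in $[0,\infty]$; the minima range over $\psi\in[\phi,\infty]$ and $\lambda\in[0,\infty]$. *)

(* Defs.v *)
From HB Require Import structures.
From mathcomp Require Export all_boot all_order all_algebra.
From mathcomp Require Export all_classical all_reals all_analysis.

Set Implicit Arguments.
Unset Strict Implicit.
Unset Printing Implicit Defensive.

Export Order.TTheory GRing.Theory Num.Theory.
Export numFieldNormedType.Exports.

Local Open Scope classical_set_scope.
Local Open Scope ring_scope.

(* Product rule over the full index set only: choosing A i = setT gives the
   rule for every subfamily. *)
Definition mutually_independent {d d' : measure_display}
    {T : measurableType d} {T' : measurableType d'} {R : realType}
    (P : probability T R) (I : finType) (X : I -> {RV P >-> T'}) : Prop :=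
  forall A : I -> set T', (forall i, measurable (A i)) ->
    P (\bigcap_i (X i @^-1` A i)) = (\prod_i P (X i @^-1` A i))%E.

Definition identically_distributed {d d' : measure_display}
    {T : measurableType d} {T' : measurableType d'} {R : realType}
    (P : probability T R) (I : finType) (X : I -> {RV P >-> T'}) : Prop :=
  forall (i j : I) (A : set T'), measurable A ->
    distribution P (X i) A = distribution P (X j) A.

Definition iid {d d' : measure_display}
    {T : measurableType d} {T' : measurableType d'} {R : realType}
    (P : probability T R) (I : finType) (X : I -> {RV P >-> T'}) : Prop :=
  mutually_independent X /\ identically_distributed X.

Definition dist_fun {R : realType} (H : probability R R) (t : R) : R :=
  fine (H `]-oo, t]%classic).

Definition cvg_weakly {R : realType} (F : nat -> R -> R)
    (H : probability R R) : Prop :=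
  forall t : R, {for t, continuous (dist_fun H)} ->
    F m t @[m --> \oo] --> dist_fun H t.

Definition sqnorm {R : realType} (p : nat) (b : 'cV[R]_p) : R :=
  \sum_j b j 0 ^+ 2.

(* The problem of index m has sample size nn m, dimension pp m and subsample
   size kk m. The covariance comes with an eigendecomposition. *)
Record ridge_data {d : measure_display} {T : measurableType d}
    {R : realType} (P : probability T R) := RidgeData {
  nn : nat -> nat;
  pp : nat -> nat;
  kk : nat -> nat;
  kk_gt0 : forall m, (0 < kk m)%N;
  kk_le_nn : forall m, (kk m <= nn m)%N;
  sample : forall m, 'I_(nn m) -> {RV P >-> ((pp m).-tuple R * R)%type};
  sample_iid : forall m, iid (@sample m);
  Sigma : forall m, 'M[R]_(pp m);
  eigval : forall m, 'I_(pp m) -> R;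
  eigvec : forall m, 'I_(pp m) -> 'cV[R]_(pp m);
  eigvec_orthonormal : forall m (i j : 'I_(pp m)),
    (eigvec i)^T *m eigvec j = ((i == j)%:R)%:M;
  Sigma_spectral : forall m,
    Sigma m = \sum_j eigval j *: (eigvec j *m (eigvec j)^T)
}.

Section Assumptions.
Context {d : measure_display} {T : measurableType d} {R : realType}.
Context {P : probability T R} (D : ridge_data P).

Definition feature (m : nat) (i : 'I_(nn D m)) (w : T) : 'cV[R]_(pp D m) :=
  \col_j tnth (sample i w).1 j.

Definition response (m : nat) (i : 'I_(nn D m)) (w : T) : R := (sample i w).2.

(* The symmetric positive semidefinite square root. *)
Definition Sigma_sqrt (m : nat) : 'M[R]_(pp D m) :=
  \sum_j Num.sqrt (eigval (r:=D) j) *: (eigvec (r:=D) j *m (eigvec j)^T).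

Definition first (m : nat) : 'I_(nn D m) :=
  Ordinal (leq_trans (kk_gt0 D m) (kk_le_nn D m)).

(* The law of the pair (x, y) is that of the first sample. *)
Definition beta0 (m : nat) : 'cV[R]_(pp D m) :=
  let x := feature (first m) in
  let y := response (first m) in
  invmx (\matrix_(a < pp D m, b < pp D m)
           fine ('E_P[(fun w => x w a 0 * x w b 0)%R])%E)
    *m \col_(a < pp D m) fine ('E_P[(fun w => x w a 0 * y w)%R])%E.

Definition f_NL (m : nat) (w : T) : R :=
  response (first m) w - ((feature (first m) w)^T *m beta0 m) 0 0.

Definition proportional_regime (phi : R) (psi : \bar R) : Prop :=
  [/\ nn D m @[m --> \oo] --> \oo,
      pp D m @[m --> \oo] --> \oo,
      kk D m @[m --> \oo] --> \oo,
      (pp D m)%:R / (nn D m)%:R @[m --> \oo] --> phi &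
      ((pp D m)%:R / (kk D m)%:R)%:E @[m --> \oo] --> psi].

Definition assumption_A1 : Prop :=
  exists mu M : R, 0 < mu /\
    forall m (i : 'I_(nn D m)),
      ('E_P[response i] = 0)%E /\
      ('E_P[(fun w => `|response i w| `^ (4 + mu))%R] <= M%:E)%E.

Definition assumption_A2 : Prop :=
  exists nu M rmin rmax : R, [/\ 0 < nu, 0 < rmin, rmin <= rmax,
    forall m, (Sigma D m)^T = Sigma D m /\
      forall a, eigenvalue (Sigma D m) a -> rmin <= a <= rmax &
    exists z : forall m, 'I_(nn D m) -> 'I_(pp D m) -> {RV P >-> R},
      forall m (i : 'I_(nn D m)),
        [/\ iid (z m i),
            forall j, ('E_P[z m i j] = 0)%E,
            forall j, ('V_P[z m i j] = 1)%E,
            forall j, ('E_P[(fun w => `|z m i j w| `^ (4 + nu))%R] <= M%:E)%E &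
            forall w, feature i w = Sigma_sqrt m *m \col_j z m i j w]].

Definition spectral_dist (m : nat) (t : R) : R :=
  (pp D m)%:R^-1 * \sum_(j < pp D m) (eigval j <= t)%R%:R.

Definition assumption_A3 (H : probability R R) : Prop :=
  cvg_weakly spectral_dist H.

Definition signal_dist (m : nat) (t : R) : R :=
  (sqnorm (beta0 m))^-1 *
  \sum_(j < pp D m) (((beta0 m)^T *m eigvec j) 0 0) ^+ 2 * (eigval j <= t)%R%:R.

Definition assumption_A4 (G : probability R R) (rho2 sigma2 : R) : Prop :=
  [/\ cvg_weakly signal_dist G,
      sqnorm (beta0 m) @[m --> \oo] --> rho2 &
      ('E_P[(fun w => f_NL m w ^+ 2)%R])%E @[m --> \oo] --> sigma2%:E].

End Assumptions.

Section LimitingRisk.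
Context {R : realType} (H G : probability R R) (rho2 sigma2 : R).

(* Used for 0 < lam and 0 < psi, where the solution is unique; it is positive
   because the equation involves 1 / v. *)
Definition fixed_point (lam psi : R) : R :=
  xget 0 [set v : R |
    0 < v /\ v^-1 = lam + psi * \int[H]_r (r / (1 + v * r))].

Definition v_tilde (lam phi psi : R) : R :=
  let v := fixed_point lam psi in
  let I := \int[H]_r (r ^+ 2 / (1 + v * r) ^+ 2) in
  phi * I / (v ^- 2 - phi * I).

Definition c_tilde (lam phi psi : R) : R :=
  let v := fixed_point lam psi in
  (1 + v_tilde lam phi psi) * \int[G]_r (r / (1 + v * r) ^+ 2).

Definition finite_risk (lam phi psi : R) : R :=
  rho2 * c_tilde lam phi psi + sigma2 * v_tilde lam phi psi.

(* Only 0 <= lam is meaningful; the values at lam = 0 and lam = +oo are limits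
   in the extended reals, where they may be +oo. *)
Definition risk_finite_psi (lam : \bar R) (phi psi : R) : \bar R :=
  match lam with
  | l%:E => if 0 < l then (finite_risk l phi psi)%:E
            else lim ((finite_risk l' phi psi)%:E @[l' --> 0^'+])
  | +oo%E => lim ((finite_risk l' phi psi)%:E @[l' --> +oo])
  | -oo%E => 0%E
  end.

Definition risk (lam : \bar R) (phi : R) (psi : \bar R) : \bar R :=
  match psi with
  | s%:E => risk_finite_psi lam phi s
  | +oo%E => lim (risk_finite_psi lam phi s @[s --> +oo])
  | -oo%E => 0%E
  end.

Definition ridgeless_risks (phi : R) : set (\bar R) :=
  [set risk 0%E phi psi | psi in [set psi | (phi%:E <= psi)%E]].

Definition ridge_risks (phi : R) : set (\bar R) :=
  [set risk lam phi phi%:E | lam in [set lam | (0 <= lam)%E]].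

(* These are minima when the infimum belongs to the set of risks. *)
Definition optimal_ridgeless_risk (phi : R) : \bar R :=
  ereal_inf (ridgeless_risks phi).

Definition optimal_ridge_risk (phi : R) : \bar R :=
  ereal_inf (ridge_risks phi).

End LimitingRisk.

(* Main.v *)
(* Multiplying the fixed-point equation by v turns it into
   lam * v + psi * a(v) = 1, with a(v) = int v r / (1 + v r) dH continuous and
   strictly increasing from 0 to 1. With b(v) = int (v r / (1 + v r))^2 dH <= a(v)
   and q(v) = int r / (1 + v r)^2 dG, the limiting risk becomes
     F(phi, v) = (rho^2 q(v) + sigma^2 phi b(v)) / (1 - phi b(v)),
   so that lam and psi only enter through v. Varying psi at lam = 0, or varying
   lam at psi = phi, both sweep out exactly the v >= 0 with phi a(v) <= 1, plus
   the limit v -> +oo when phi <= 1: the ridgeless and the ridge problem minimise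
   the same function over the same set. As phi grows this set shrinks while
   F(phi, v) increases, hence so does the minimum. *)
Require Import Defs.
From mathcomp Require Import measurable_realfun ring lra.

Set Implicit Arguments.
Unset Strict Implicit.
Unset Printing Implicit Defensive.

Local Open Scope classical_set_scope.
Local Open Scope ring_scope.

(** * Averages under a concentrated probability *)

Section Concentrated.
Context {R : realType} (A B : R) (A_gt0 : 0 < A).
Implicit Types (f g : R -> R) (v r : R).

(** Boundedness is asked on [[A, B]] only: for [v > 0] the resolvent [(1 + v * r)^-1] blows up near
    [r = - v^-1], a point outside the support. *)
Definition bounded_measurable (f : R -> R) : Prop :=
  measurable_fun setT f /\
  exists M, forall r, r \in `[A, B] -> `|f r| <= M.

Lemma bounded_measurable_cst (c : R) : bounded_measurable (fun=> c).
Proof. by split => //; exists `|c|. Qed.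

Lemma bounded_measurable_id : bounded_measurable id.
Proof.
split => //; exists B => r; rewrite in_itv/= => /andP[Ar rB].
by rewrite ger0_norm// (le_trans _ Ar)// ltW.
Qed.

Lemma bounded_measurableM f g : bounded_measurable f -> bounded_measurable g ->
  bounded_measurable (fun r => f r * g r).
Proof.
move=> [mf [M fM]] [mg [N gN]]; split; first exact: measurable_funM.
exists (M * N) => r rAB; rewrite normrM.
by apply: ler_pM => //; [exact: fM|exact: gN].
Qed.

Lemma bounded_measurableB f g : bounded_measurable f -> bounded_measurable g ->
  bounded_measurable (fun r => f r - g r).
Proof.
move=> [mf [M fM]] [mg [N gN]]; split; first exact: measurable_funB.
exists (M + N) => r rAB; rewrite (le_trans (ler_normB _ _))//.
by apply: lerD; [exact: fM|exact: gN].
Qed.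

(** Inversion is continuous on the open set of nonzero reals, and on the single point 0
    measurability is trivial. *)
Lemma measurable_inv : measurable_fun setT (fun x : R => x^-1).
Proof.
rewrite -(setvU [set 0 : R]); apply/measurable_funU => //.
- exact: measurableC.
- split; last exact: measurable_fun_set1.
  apply: open_continuous_measurable_fun.
    by apply: closed_openC; exact: closed_eq.
  by move=> x; rewrite inE/= => /eqP x0; apply: cvgV.
Qed.

Lemma bounded_measurable_resolvent v : 0 <= v ->
  bounded_measurable (fun r => (1 + v * r)^-1).
Proof.
move=> v0; split.
  apply: (measurableT_comp measurable_inv).
  by apply: measurable_funD => //; exact: measurable_funM.
exists 1 => r; rewrite in_itv/= => /andP[Ar rB].
have r0 : 0 <= r by rewrite (le_trans _ Ar)// ltW.
have vr : 1 <= 1 + v * r by rewrite lerDl mulr_ge0.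
by rewrite ger0_norm ?invr_ge0 ?(le_trans _ vr)// invf_le1 ?(lt_le_trans _ vr).
Qed.

Variables (P : probability R R) (PAB : P `[A, B]%classic = 1%E).

(** The complement of [[A, B]] is null, so [f] agrees almost everywhere with its restriction. On the
    interval boundedness gives integrability, which opens the way to order and linearity. *)
Lemma Rintegral_concentrated f : bounded_measurable f ->
  \int[P]_r f r = \int[P]_(r in `[A, B]) f r.
Proof.
move=> [mf _]; congr fine.
rewrite [RHS]integral_mkcond; apply: ae_eq_integral => //.
- exact/measurable_EFinP.
- apply/(measurable_restrictT _ _).1 => //; apply/measurable_EFinP.
  exact: measurable_funTS.
- exists (~` `[A, B]); split; first exact: measurableC.
    by apply: etrans (probability_setC P (measurable_itv `[A, B])) _; rewrite PAB subee.
  move=> x/=; apply: contra_not => xAB _.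
  by rewrite patchE mem_set.
Qed.

Lemma integrable_concentrated f : bounded_measurable f ->
  P.-integrable `[A, B]%classic (EFin \o f).
Proof.
move=> [mf [M fM]]; apply: measurable_bounded_integrable => //.
- exact: le_lt_trans (probability_le1 P (measurable_itv `[A, B])) (ltry 1).
- exact: measurable_funTS.
- exists M; split => [|x Mx r rAB]; first exact: num_real.
  exact: le_trans (fM r rAB) (ltW Mx).
Qed.

Lemma mean_le f g : bounded_measurable f -> bounded_measurable g ->
  (forall r, A <= r -> r <= B -> f r <= g r) -> \int[P]_r f r <= \int[P]_r g r.
Proof.
move=> bf bg fg; rewrite !Rintegral_concentrated//.
apply: le_Rintegral => //; try exact: integrable_concentrated.
by move=> r /=; rewrite in_itv/= => /andP[]; exact: fg.
Qed.

Lemma meanZ c f : bounded_measurable f ->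
  \int[P]_r (c * f r) = c * \int[P]_r f r.
Proof.
move=> bf; rewrite !Rintegral_concentrated//; last first.
  by apply: bounded_measurableM => //; exact: bounded_measurable_cst.
by apply: RintegralZl => //; exact: integrable_concentrated.
Qed.

Lemma meanB f g : bounded_measurable f -> bounded_measurable g ->
  \int[P]_r (f r - g r) = \int[P]_r f r - \int[P]_r g r.
Proof.
move=> bf bg; rewrite !Rintegral_concentrated//; last exact: bounded_measurableB.
by apply: RintegralB => //; exact: integrable_concentrated.
Qed.

Lemma mean_cst (c : R) : \int[P]_r c = c.
Proof.
rewrite [LHS](Rintegral_cst P measurableT c).
by rewrite (congr1 fine (probability_setT P) : fine _ = 1) mulr1.
Qed.

Lemma mean_dist f g (c : R) : bounded_measurable f -> bounded_measurable g ->
  (forall r, A <= r -> r <= B -> `|f r - g r| <= c) ->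
  `|\int[P]_r f r - \int[P]_r g r| <= c.
Proof.
move=> bf bg fg; rewrite -meanB//.
have bfg := bounded_measurableB bf bg.
rewrite ler_norml -{1}(mean_cst (- c)) -{2}(mean_cst c); apply/andP; split.
- apply: mean_le => // [|r Ar rB]; first exact: bounded_measurable_cst.
  by have := fg r Ar rB; rewrite ler_norml => /andP[].
- apply: mean_le => // [|r Ar rB]; first exact: bounded_measurable_cst.
  by have := fg r Ar rB; rewrite ler_norml => /andP[].
Qed.

End Concentrated.

(** * Resolvent integrals, their Lipschitz bounds and the degrees of freedom *)

Section Transforms.
Context {R : realType}.

Definition mean1 (P : probability R R) (v : R) : R :=
  \int[P]_r (r / (1 + v * r)).

Definition mean2 (P : probability R R) (v : R) : R :=
  \int[P]_r (r ^+ 2 / (1 + v * r) ^+ 2).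

Definition mean12 (P : probability R R) (v : R) : R :=
  \int[P]_r (r / (1 + v * r) ^+ 2).

(** For [v > 0] these are the normalised degrees of freedom, of first and second order, of ridge
    regression with penalty [v^-1], since [v r / (1 + v r) = r / (r + v^-1)]. *)
Definition dof1 (P : probability R R) (v : R) : R := v * mean1 P v.
Definition dof2 (P : probability R R) (v : R) : R := v ^+ 2 * mean2 P v.

(** The Lipschitz bounds hold at nonnegative arguments; composing with the absolute value gives a
    function continuous on the whole line, fit for the intermediate and extreme value theorems. *)
Lemma lipschitz_continuous_norm (f : R -> R) (C : R) :
  (forall v w, 0 <= v -> 0 <= w -> `|f v - f w| <= C * `|v - w|) ->
  continuous (fun v : R => f `|v|).
Proof.
move=> fC x; apply/cvgrPdist_le => e e0.
have C1 : 0 < `|C| + 1 by rewrite ltr_wpDl.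
near=> y.
apply: le_trans (fC _ _ _ _) _ => //.
have : `| `|x| - `|y| | <= e / (`|C| + 1).
  apply: le_trans (ler_dist_dist _ _) _.
  near: y; move: (e / _) (divr_gt0 e0 C1) => d d0; exact: cvgr_dist_le d d0.
rewrite ler_pdivlMr// => /(le_trans _); apply.
rewrite mulrC ler_wpM2l// (le_trans (ler_norm _))// lerDl.
Unshelve. all: by end_near. Qed.

Context (A B : R) (A_gt0 : 0 < A) (AB : A <= B).
Implicit Types (v w r : R).
Variables (P : probability R R) (PAB : P `[A, B]%classic = 1%E).

Let bres := bounded_measurable_resolvent B A_gt0.
Let bid := bounded_measurable_id B A_gt0.

Lemma mean1E v : mean1 P v = \int[P]_r (r * (1 + v * r)^-1).
Proof. by []. Qed.

Lemma mean2E v :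
  mean2 P v = \int[P]_r ((r * (1 + v * r)^-1) * (r * (1 + v * r)^-1)).
Proof.
by congr Rintegral; apply/funext => r; rewrite !expr2 invfM mulrACA.
Qed.

Lemma mean12E v :
  mean12 P v = \int[P]_r (r * ((1 + v * r)^-1 * (1 + v * r)^-1)).
Proof. by congr Rintegral; apply/funext => r; rewrite !expr2 invfM. Qed.

Lemma bounded_measurable1 v : 0 <= v ->
  bounded_measurable A B (fun r => r * (1 + v * r)^-1).
Proof. by move=> v0; exact: (bounded_measurableM bid (bres v0)). Qed.

Lemma bounded_measurable2 v : 0 <= v -> bounded_measurable A B
  (fun r => (r * (1 + v * r)^-1) * (r * (1 + v * r)^-1)).
Proof.
by move=> v0; apply: bounded_measurableM; exact: bounded_measurable1.
Qed.

Lemma bounded_measurable12 v : 0 <= v -> bounded_measurable A B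
  (fun r => r * ((1 + v * r)^-1 * (1 + v * r)^-1)).
Proof.
move=> v0; apply: bounded_measurableM => //.
by apply: bounded_measurableM; exact: bres.
Qed.

(* Every pointwise estimate below is polynomial in [x = (1 + v * r)^-1]. *)
Lemma resolvent_facts v r : 0 <= v -> A <= r ->
  let x := (1 + v * r)^-1 in [/\ 0 < r, 0 < x, x <= 1 & v * r * x = 1 - x].
Proof.
move=> v0 Ar x; have r0 : 0 < r by exact: lt_le_trans Ar.
have vr : 1 <= 1 + v * r by rewrite lerDl mulr_ge0// ltW.
have vr0 : 0 < 1 + v * r by exact: lt_le_trans vr.
split => //; rewrite /x ?invr_gt0 ?invf_le1//.
by field; rewrite gt_eqF.
Qed.

Lemma resolvent_le v r s : 0 <= v -> A <= r -> r <= s ->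
  (1 + v * s)^-1 <= (1 + v * r)^-1.
Proof.
move=> v0 Ar rs; have r0 : 0 < r by exact: lt_le_trans Ar.
have vr u : r <= u -> 0 < 1 + v * u.
  by move=> ru; rewrite ltr_pwDl// mulr_ge0// (le_trans (ltW r0)).
by rewrite lef_pV2 ?posrE ?vr// lerD2l ler_wpM2l.
Qed.

(** The resolvent identity, the source of both the Lipschitz bounds and the strict monotonicity of
    [dof1]. *)
Lemma resolvent_diff v w r : 0 <= v -> 0 <= w -> A <= r ->
  (1 + v * r)^-1 - (1 + w * r)^-1 =
  (w - v) * r * ((1 + v * r)^-1 * (1 + w * r)^-1).
Proof.
move=> v0 w0 Ar; have r0 : 0 < r by exact: lt_le_trans Ar.
have vr0 : 0 < 1 + v * r by rewrite ltr_pwDl// mulr_ge0// ltW.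
have wr0 : 0 < 1 + w * r by rewrite ltr_pwDl// mulr_ge0// ltW.
by field; rewrite !gt_eqF.
Qed.

Lemma resolvent_dist v w r : 0 <= v -> 0 <= w -> A <= r -> r <= B ->
  `|(1 + v * r)^-1 - (1 + w * r)^-1| <= B * `|v - w|.
Proof.
move=> v0 w0 Ar rB; rewrite resolvent_diff//.
have [r0 x0 x1 _] := resolvent_facts v0 Ar.
have [_ y0 y1 _] := resolvent_facts w0 Ar.
rewrite !normrM (distrC w) (gtr0_norm r0) (gtr0_norm x0) (gtr0_norm y0).
rewrite [leRHS]mulrC -mulrA ler_wpM2l//.
rewrite -[leRHS]mulr1 ler_pM ?mulr_ge0 ?(ltW r0) ?(ltW x0) ?(ltW y0)//.
by rewrite mulr_ile1 ?(ltW x0) ?(ltW y0).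
Qed.

Lemma mean1_lipschitz v w : 0 <= v -> 0 <= w ->
  `|mean1 P v - mean1 P w| <= B * B * `|v - w|.
Proof.
move=> v0 w0; rewrite !mean1E.
apply: (mean_dist PAB) => [||r Ar rB]; try exact: bounded_measurable1.
have [r0 _ _ _] := resolvent_facts v0 Ar.
rewrite -mulrBr normrM (gtr0_norm r0) -mulrA ler_pM ?(ltW r0)//.
exact: resolvent_dist.
Qed.

Lemma mean2_lipschitz v w : 0 <= v -> 0 <= w ->
  `|mean2 P v - mean2 P w| <= 2 * B ^+ 3 * `|v - w|.
Proof.
move=> v0 w0; rewrite !mean2E.
apply: (mean_dist PAB) => [||r Ar rB]; try exact: bounded_measurable2.
have [r0 x0 x1 _] := resolvent_facts v0 Ar.
have [_ y0 y1 _] := resolvent_facts w0 Ar.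
have := resolvent_dist v0 w0 Ar rB.
set x := (1 + v * r)^-1 in x0 x1 *; set y := (1 + w * r)^-1 in y0 y1 *.
move=> xy.
(* A difference of squares: the last factor is bounded by [xy], the others by [r <= B] and
   [x + y <= 2]. *)
rewrite (_ : _ - _ = r * r * (x + y) * (x - y)); last by ring.
rewrite normrM ger0_norm; last by rewrite !mulr_ge0// ?addr_ge0// ltW.
have B0 : 0 <= B by rewrite (le_trans _ rB)// ltW.
rewrite (_ : 2 * B ^+ 3 * _ = B * B * 2 * (B * `|v - w|)); last by ring.
apply: ler_pM => //; first by rewrite !mulr_ge0// ?addr_ge0// ltW.
apply: ler_pM; rewrite ?mulr_ge0 ?addr_ge0 ?(ltW r0) ?(ltW x0) ?(ltW y0)//.
  by rewrite ler_pM ?(ltW r0).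
by rewrite lerD.
Qed.

Lemma mean12_lipschitz v w : 0 <= v -> 0 <= w ->
  `|mean12 P v - mean12 P w| <= 2 * B ^+ 2 * `|v - w|.
Proof.
move=> v0 w0; rewrite !mean12E.
apply: (mean_dist PAB) => [||r Ar rB]; try exact: bounded_measurable12.
have [r0 x0 x1 _] := resolvent_facts v0 Ar.
have [_ y0 y1 _] := resolvent_facts w0 Ar.
have := resolvent_dist v0 w0 Ar rB.
set x := (1 + v * r)^-1 in x0 x1 *; set y := (1 + w * r)^-1 in y0 y1 *.
move=> xy.
rewrite (_ : _ - _ = r * (x + y) * (x - y)); last by ring.
rewrite normrM ger0_norm; last by rewrite !mulr_ge0// ?addr_ge0// ltW.
have B0 : 0 <= B by rewrite (le_trans _ rB)// ltW.
rewrite (_ : 2 * B ^+ 2 * _ = B * 2 * (B * `|v - w|)); last by ring.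
apply: ler_pM => //; first by rewrite !mulr_ge0// ?addr_ge0// ltW.
apply: ler_pM; rewrite ?mulr_ge0 ?addr_ge0 ?(ltW r0) ?(ltW x0) ?(ltW y0)//.
by rewrite lerD.
Qed.

Lemma dof1E v : 0 <= v -> dof1 P v = \int[P]_r (v * (r * (1 + v * r)^-1)).
Proof.
move=> v0; rewrite /dof1 mean1E [RHS](meanZ PAB)//.
exact: bounded_measurable1.
Qed.

Lemma dof2E v : 0 <= v -> dof2 P v = \int[P]_r
  (v ^+ 2 * ((r * (1 + v * r)^-1) * (r * (1 + v * r)^-1))).
Proof.
move=> v0; rewrite /dof2 mean2E [RHS](meanZ PAB)//.
exact: bounded_measurable2.
Qed.

(** The integrand is [1 - (1 + v * r)^-1], which does not decrease in [r], so its value at [B]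
    bounds the average; the value at [A] gives the lower bound. *)
Lemma dof1_le v : 0 <= v -> dof1 P v <= 1 - (1 + v * B)^-1.
Proof.
move=> v0; rewrite dof1E// -[leRHS](mean_cst P).
apply: (mean_le PAB) => [||r Ar rB].
- exact: (bounded_measurableM (bounded_measurable_cst _ _ v)
    (bounded_measurable1 v0)).
- exact: bounded_measurable_cst.
- have [r0 x0 x1 xE] := resolvent_facts v0 Ar.
  by rewrite mulrA xE lerD2l lerN2 resolvent_le.
Qed.

Lemma dof1_ge v : 0 <= v -> 1 - (1 + v * A)^-1 <= dof1 P v.
Proof.
move=> v0; rewrite dof1E// -[leLHS](mean_cst P).
apply: (mean_le PAB) => [||r Ar rB].
- exact: bounded_measurable_cst.
- exact: (bounded_measurableM (bounded_measurable_cst _ _ v)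
    (bounded_measurable1 v0)).
- have [r0 x0 x1 xE] := resolvent_facts v0 Ar.
  by rewrite mulrA xE lerD2l lerN2 resolvent_le.
Qed.

Lemma dof1_lt1 v : 0 <= v -> dof1 P v < 1.
Proof.
move=> v0; apply: le_lt_trans (dof1_le v0) _.
have [_ x0 _ _] := resolvent_facts v0 AB.
by rewrite ltrBlDr ltrDl.
Qed.

Lemma dof1_lt v w : 0 <= v -> v < w -> dof1 P v < dof1 P w.
Proof.
move=> v0 vw; have w0 : 0 <= w by rewrite ltW// (le_lt_trans v0).
have B0 : 0 < B by exact: lt_le_trans AB.
(* By the resolvent identity the integrands differ by [w - v] times [r] times both resolvents.
   Bounding each factor below over [[A, B]] gives a gap [c] uniform in [r], so the integrals differ
   strictly. *)
pose c := (w - v) * A * ((1 + v * B)^-1 * (1 + w * B)^-1).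
have [_ xB0 _ _] := resolvent_facts v0 AB.
have [_ yB0 _ _] := resolvent_facts w0 AB.
have c0 : 0 < c by rewrite /c !mulr_gt0// subr_gt0.
rewrite -subr_gt0; apply: lt_le_trans c0 _.
rewrite !dof1E//.
have bm u : 0 <= u ->
    bounded_measurable A B (fun r => u * (r * (1 + u * r)^-1)).
  move=> u0; exact: (bounded_measurableM (bounded_measurable_cst _ _ u)
    (bounded_measurable1 u0)).
rewrite -[leRHS](meanB PAB (bm w w0) (bm v v0)) -[leLHS](mean_cst P).
apply: (mean_le PAB) => [||r Ar rB].
- exact: bounded_measurable_cst.
- exact: (bounded_measurableB (bm w w0) (bm v v0)).
- have [r0 x0 x1 xE] := resolvent_facts v0 Ar.
  have [_ y0 y1 yE] := resolvent_facts w0 Ar.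
  rewrite !mulrA yE xE.
  rewrite (_ : _ - _ = (1 + v * r)^-1 - (1 + w * r)^-1); last by ring.
  rewrite resolvent_diff//.
  rewrite /c; apply: ler_pM.
  + by rewrite mulr_ge0 ?subr_ge0// ltW.
  + by rewrite mulr_ge0// ltW.
  + by rewrite ler_wpM2l ?subr_ge0// ltW.
  + by rewrite ler_pM ?resolvent_le// ltW.
Qed.

Lemma dof1_ge0 v : 0 <= v -> 0 <= dof1 P v.
Proof.
move=> v0; apply: le_trans (dof1_ge v0).
have [_ _ x1 _] := resolvent_facts v0 (lexx A).
by rewrite subr_ge0.
Qed.

(** One of the two equal factors of the integrand is replaced by its value at [r = B]. This value is
    strictly below 1, which later keeps the denominator of the risk positive. *)
Lemma dof2_le v : 0 <= v -> dof2 P v <= (1 - (1 + v * B)^-1) * dof1 P v.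
Proof.
move=> v0; have bm : bounded_measurable A B (fun r => v * (r * (1 + v * r)^-1)).
  exact: (bounded_measurableM (bounded_measurable_cst _ _ v)
    (bounded_measurable1 v0)).
rewrite dof2E// dof1E// -[leRHS](meanZ PAB)//.
apply: (mean_le PAB) => [||r Ar rB].
- exact: (bounded_measurableM (bounded_measurable_cst _ _ _)
    (bounded_measurable2 v0)).
- exact: (bounded_measurableM (bounded_measurable_cst _ _ _) bm).
- have [r0 x0 x1 xE] := resolvent_facts v0 Ar.
  rewrite expr2 mulrACA ler_wpM2r//.
    by rewrite !mulr_ge0// ltW.
  by rewrite mulrA xE lerD2l lerN2 resolvent_le.
Qed.

Lemma dof2_ge v : 0 <= v -> (1 - (1 + v * A)^-1) ^+ 2 <= dof2 P v.
Proof.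
move=> v0; rewrite dof2E// -[leLHS](mean_cst P).
apply: (mean_le PAB) => [||r Ar rB].
- exact: bounded_measurable_cst.
- exact: (bounded_measurableM (bounded_measurable_cst _ _ _)
    (bounded_measurable2 v0)).
- have [r0 x0 x1 xE] := resolvent_facts v0 Ar.
  have [_ a0 a1 _] := resolvent_facts v0 (lexx A).
  rewrite !expr2 mulrACA.
  have le : 1 - (1 + v * A)^-1 <= v * (r * (1 + v * r)^-1).
    by rewrite mulrA xE lerD2l lerN2 resolvent_le.
  by apply: ler_pM => //; rewrite subr_ge0.
Qed.

Lemma mean12_ge0 v : 0 <= v -> 0 <= mean12 P v.
Proof.
move=> v0; rewrite mean12E -[leLHS](mean_cst P).
apply: (mean_le PAB) => [||r Ar rB].
- exact: bounded_measurable_cst.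
- exact: bounded_measurable12.
- have [r0 x0 x1 xE] := resolvent_facts v0 Ar.
  by rewrite !mulr_ge0// ltW.
Qed.

(** One resolvent is absorbed by [v r / (1 + v r) <= 1], the other is largest at [A]. The decay of
    order [v ^- 2] matters at [phi = 1], where the denominator of the risk may vanish like
    [v^-1]. *)
Lemma mean12_le v : 0 < v -> mean12 P v <= v^-1 * (1 + v * A)^-1.
Proof.
move=> v_gt0; have v0 := ltW v_gt0.
rewrite mean12E -[leRHS](mean_cst P).
apply: (mean_le PAB) => [||r Ar rB].
- exact: bounded_measurable12.
- exact: bounded_measurable_cst.
- have [r0 x0 x1 xE] := resolvent_facts v0 Ar.
  have [_ a0 a1 _] := resolvent_facts v0 (lexx A).
  rewrite mulrA ler_pM// ?mulr_ge0 ?(ltW r0) ?(ltW x0)//.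
    rewrite -(ler_pM2l v_gt0) divff ?gt_eqF// mulrA xE.
    by rewrite lerBlDr lerDl ltW.
  exact: resolvent_le.
Qed.

End Transforms.

(** * Weak limits of distribution functions *)

Section WeakLimits.
Context {R : realType}.

(** A monotone function has countably many discontinuities, a Lebesgue null set, whereas []x, y[]
    has positive length. *)
Lemma nondecreasing_continuity_point (F : R -> R) (x y : R) :
  nondecreasing_fun F -> x < y ->
  exists t, [/\ x < t, t < y & {for t, continuous F}].
Proof.
move=> ndF xy; apply: contrapT => noncont.
have /countable_lebesgue_measure0 : countable `]x, y[%classic.
  have ndF' : {in `[x, y] &, nondecreasing_fun F} by move=> ? ? _ _; exact: ndF.
  apply: sub_countable (discontinuity_countable ndF').
  apply: subset_card_le => t xty; split => //.
  have cl : cvg (F s @[s --> t^'-]).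
    apply: nondecreasing_at_left_is_cvgr; near=> u.
      by move=> p q _ _; exact: ndF.
    by exists (F t) => z [s /=]; rewrite in_itv/= => /andP[_ /ltW st <-]; exact: ndF.
  have cr : cvg (F s @[s --> t^'+]).
    apply: nondecreasing_at_right_is_cvgr; near=> u.
      by move=> p q _ _; exact: ndF.
    by exists (F t) => z [s /=]; rewrite in_itv/= => /andP[/ltW st _ <-]; exact: ndF.
  (* [F t] lies between the one-sided limits; if these agreed, [F] would be continuous at [t],
     against [noncont]. *)
  split => //; apply/eqP => lr; apply: noncont; exists t.
  move: (xty); rewrite /= in_itv/= => /andP[xt ty]; split => //.
  have lF : lim (F s @[s --> t^'-]) <= F t.
    apply: limr_le => //; near=> s; apply: ndF; apply: ltW.
    by near: s; exact: nbhs_left_lt.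
  have Fr : F t <= lim (F s @[s --> t^'+]).
    apply: limr_ge => //; near=> s; apply: ndF; apply: ltW.
    by near: s; exact: nbhs_right_gt.
  apply/left_right_continuousP; split.
    by rewrite (_ : F t = lim (F s @[s --> t^'-]))//; apply/eqP; rewrite eq_le lF lr Fr.
  by rewrite (_ : F t = lim (F s @[s --> t^'+]))//; apply/eqP; rewrite eq_le Fr -lr lF.
rewrite lebesgue_measure_itv/= lte_fin xy -EFinB => /eqP.
by rewrite eqe subr_eq0 gt_eqF.
Unshelve. all: by end_near. Qed.

Variable P : probability R R.

Lemma EFin_dist_fun t : (dist_fun P t)%:E = P `]-oo, t]%classic.
Proof. by rewrite /dist_fun fineK// fin_num_measure. Qed.

Lemma dist_fun_nondecreasing : nondecreasing_fun (dist_fun P).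
Proof.
move=> s t st; rewrite -lee_fin !EFin_dist_fun le_measure ?inE//.
exact: subitvPr.
Qed.

Lemma dist_fun_le1 t : dist_fun P t <= 1.
Proof. by rewrite -lee_fin EFin_dist_fun probability_le1. Qed.

Lemma dist_fun_cvg1 : dist_fun P n%:R @[n --> \oo] --> (1 : R).
Proof.
have : P `]-oo, n%:R]%classic @[n --> \oo] --> P setT.
  have -> : setT = \bigcup_n `]-oo, n%:R]%classic :> set R.
    apply/esym; rewrite -subTset => t _/=.
    by exists (Num.truncn t).+1; rewrite //= in_itv/= ltW// truncnS_gt.
  apply: nondecreasing_cvg_mu => //; first exact: bigcup_measurable.
  move=> n m nm; apply/subsetPset => x/=; rewrite !in_itv/= => /le_trans.
  by apply; rewrite ler_nat.
rewrite probability_setT => /fine_cvg.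
exact.
Qed.

(* Weak limits of distribution functions that are constant outside
   [[rmin, rmax]] concentrate there; the enlarged interval spares the
   discussion of atoms at its end points. *)
Lemma cvg_weakly_concentrated (F : nat -> R -> R) (rmin rmax : R) :
  0 < rmin -> cvg_weakly F P ->
  (forall m t, t < rmin -> F m t = 0) ->
  (forall m t, rmax <= t -> F m t = F m rmax) ->
  P `[rmin / 2, rmax + 1]%classic = 1%E.
Proof.
move=> rmin0 FP Fmin Fmax.
have [s [s1 s2 cs]] : exists t, [/\ rmin / 2 < t, t < rmin &
    {for t, continuous (dist_fun P)}].
  by apply: nondecreasing_continuity_point; [exact: dist_fun_nondecreasing|lra].
have [t [t1 t2 ct]] : exists t, [/\ rmax < t, t < rmax + 1 &
    {for t, continuous (dist_fun P)}].
  by apply: nondecreasing_continuity_point; [exact: dist_fun_nondecreasing|lra].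
have Ps : P `]-oo, s]%classic = 0%E.
  rewrite -EFin_dist_fun; congr EFin.
  apply: (@cvg_unique _ (@Rhausdorff R) (F m s @[m --> \oo])) => //.
    exact: FP.
  rewrite (_ : (fun m => F m s) = fun=> 0); first exact: cvg_cst.
  by apply/funext => m; rewrite Fmin.
have Ft m u : rmax <= u -> F m u = F m t by move=> ru; rewrite Fmax// (Fmax _ t)// ltW.
(* The mass 1 comes from [P] itself: since each [F m] is constant past [rmax], [dist_fun P] takes
   the same value at [t] and at arbitrarily large continuity points [u], and it tends to 1. *)
have Pt : P `]-oo, t]%classic = 1%E.
  rewrite -EFin_dist_fun; congr EFin; apply/eqP; rewrite eq_le dist_fun_le1/=.
  apply: (cvgr_to_le dist_fun_cvg1); near=> n.
  have [u [u1 u2 cu]] : exists u, [/\ n%:R + `|rmax| < u, u < n%:R + `|rmax| + 1 &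
      {for u, continuous (dist_fun P)}].
    by apply: nondecreasing_continuity_point; [exact: dist_fun_nondecreasing|lra].
  have ru : rmax <= u.
    apply: le_trans (ltW u1); apply: le_trans (ler_norm _) _.
    by rewrite lerDr.
  have <- : dist_fun P u = dist_fun P t.
    apply: (@cvg_unique _ (@Rhausdorff R) (F m u @[m --> \oo])) => //.
      exact: FP.
    rewrite (_ : (fun m => F m u) = (fun m => F m t)); first exact: FP.
    by apply/funext => m; exact: Ft.
  by apply: dist_fun_nondecreasing; rewrite (le_trans _ (ltW u1))// lerDl.
pose K := `[rmin / 2, rmax + 1]%classic.
(* All the mass lies up to [t] and none up to [s], so this covering leaves mass at least 1 for
   [K]. *)
have /(le_measure P) : `]-oo, t]%classic `<=` `]-oo, s]%classic `|` K.
  move=> x /=; rewrite !in_itv/= => xt.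
  have [xs|sx] := leP x s; [by left|right].
  rewrite /K/= in_itv/=; apply/andP; split.
    by apply: ltW; exact: lt_trans sx.
  exact: le_trans xt (ltW t2).
have mt := measurable_itv `]-oo, t].
have ms := measurable_itv `]-oo, s].
have mK := measurable_itv `[rmin / 2, rmax + 1].
have mU := measurableU _ _ ms mK.
move=> /(_ (mem_set mt) (mem_set mU)) sub.
have : (P `]-oo, t]%classic <= P `]-oo, s]%classic + P K)%E.
  exact: le_trans sub (measureU2 P ms mK).
rewrite Pt Ps add0e => K1; apply/eqP.
by rewrite eq_le K1 andbT; exact: probability_le1.
Unshelve. all: by end_near. Qed.

End WeakLimits.

(** * The risk as a function of the fixed point *)

Section RiskCurve.
Context {R : realType} (H G : probability R R) (rho2 sigma2 : R).
Implicit Types (l phi s v w : R).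

(** The [F(phi, v)] of the overview: numerator and denominator of [v_tilde] have been multiplied by
    [v ^+ 2], so that [v = 0] needs no special treatment. *)
Definition risk_curve phi v : R :=
  (rho2 * mean12 G v + sigma2 * (phi * dof2 H v)) / (1 - phi * dof2 H v).

(** Kept as a limit because its closed form splits: under the hypotheses below it is
    [sigma2 * phi / (1 - phi)] for [0 < phi < 1], while at [phi = 1] it is 0 or [+oo] according to
    whether [sigma2] vanishes. *)
Definition risk_at_infinity phi : \bar R :=
  lim ((risk_curve phi v)%:E @[v --> +oo]).

Context (A B : R) (A_gt0 : 0 < A) (AB : A <= B).
Hypotheses (HAB : H `[A, B]%classic = 1%E) (GAB : G `[A, B]%classic = 1%E).
Hypotheses (rho2_ge0 : 0 <= rho2) (sigma2_ge0 : 0 <= sigma2).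

Let B_gt0 : 0 < B. Proof. exact: lt_le_trans AB. Qed.

Lemma dof1_0 : dof1 H 0 = 0. Proof. by rewrite /dof1 mul0r. Qed.

Lemma dof2_ge0 v : 0 <= v -> 0 <= dof2 H v.
Proof. by move=> v0; apply: le_trans (dof2_ge A_gt0 HAB v0); rewrite sqr_ge0. Qed.

(** The factor [1 - (1 + v * B)^-1] between [dof2] and [dof1] makes the inequality strict even when
    [phi * dof1 H v = 1], the ridgeless case. *)
Lemma phi_dof2_lt1 phi v : 0 < phi -> 0 <= v -> phi * dof1 H v <= 1 ->
  phi * dof2 H v < 1.
Proof.
move=> phi0 v0 pa; have [_ xB xB1 _] := resolvent_facts A_gt0 v0 AB.
apply: (@le_lt_trans _ _ (1 - (1 + v * B)^-1)); last by rewrite ltrBlDr ltrDl.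
apply: (@le_trans _ _ (phi * ((1 - (1 + v * B)^-1) * dof1 H v))).
  by rewrite ler_pM2l// (dof2_le A_gt0 HAB v0).
by rewrite mulrCA ler_piMr// subr_ge0.
Qed.

Lemma dof1_le_mono v w : 0 <= v -> v <= w -> dof1 H v <= dof1 H w.
Proof.
move=> v0; rewrite le_eqVlt => /predU1P[->//|vw].
by rewrite ltW// (dof1_lt A_gt0 AB HAB).
Qed.

Lemma phi_dof1_lt1 phi v : 0 < phi -> phi <= 1 -> 0 <= v -> phi * dof1 H v < 1.
Proof.
move=> p0 p1 v0; apply: le_lt_trans (dof1_lt1 A_gt0 AB HAB v0).
by rewrite ler_piMl// (dof1_ge0 A_gt0 HAB).
Qed.

Lemma risk_curve_ge0 phi v : 0 < phi -> 0 <= v -> phi * dof1 H v <= 1 ->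
  0 <= risk_curve phi v.
Proof.
move=> p0 v0 pa; rewrite divr_ge0//.
  rewrite addr_ge0// mulr_ge0//; first exact: (mean12_ge0 A_gt0 GAB).
  by rewrite mulr_ge0 ?dof2_ge0// ltW.
by rewrite subr_ge0 ltW// phi_dof2_lt1.
Qed.

Lemma risk_curve_mono phi1 phi2 v : 0 < phi1 -> phi1 <= phi2 -> 0 <= v ->
  phi2 * dof1 H v <= 1 -> risk_curve phi1 v <= risk_curve phi2 v.
Proof.
move=> p10 p12 v0 pa.
have p20 : 0 < phi2 by exact: lt_le_trans p12.
have q0 : 0 <= mean12 G v by exact: (mean12_ge0 A_gt0 GAB).
have b0 := dof2_ge0 v0.
have b12 : phi1 * dof2 H v <= phi2 * dof2 H v by rewrite ler_wpM2r.
have b2 := phi_dof2_lt1 p20 v0 pa.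
have b1 := le_lt_trans b12 b2.
rewrite /risk_curve; apply: ler_pM.
- by rewrite addr_ge0// mulr_ge0// mulr_ge0// ltW.
- by rewrite invr_ge0 subr_ge0 ltW.
- by rewrite lerD2l ler_wpM2l.
- by rewrite lef_pV2 ?posrE ?subr_gt0// lerD2l lerN2.
Qed.

Lemma dof1_continuous : continuous (fun v : R => dof1 H `|v|).
Proof.
move=> v; apply: cvgM; first exact: norm_continuous.
exact: lipschitz_continuous_norm (mean1_lipschitz A_gt0 HAB) v.
Qed.

Lemma dof2_continuous : continuous (fun v : R => dof2 H `|v|).
Proof.
move=> v; apply: cvgM; last first.
  exact: lipschitz_continuous_norm (mean2_lipschitz A_gt0 HAB) v.
by apply: cvgM; exact: norm_continuous.
Qed.

Lemma risk_curve_continuous phi v : 0 < phi -> phi * dof1 H `|v| <= 1 ->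
  {for v, continuous (fun v : R => risk_curve phi `|v|)}.
Proof.
move=> p0 pa; have pb : phi * dof2 H `|w| @[w --> v] --> phi * dof2 H `|v|.
  by apply: cvgM; [exact: cvg_cst|exact: dof2_continuous].
apply: cvgM.
  apply: cvgD; apply: cvgM => //; try exact: cvg_cst.
  exact: lipschitz_continuous_norm (mean12_lipschitz A_gt0 GAB) v.
apply: cvgV; first by rewrite gt_eqF// subr_gt0 phi_dof2_lt1.
by apply: cvgB => //; exact: cvg_cst.
Qed.

(** Serves all limits, in [lam] or in [psi], along which the fixed point stays finite. *)
Lemma risk_curve_cvg {I : Type} (K : set_system I) {FK : ProperFilter K}
    phi v (f : I -> R) :
  0 < phi -> 0 <= v -> phi * dof1 H v <= 1 ->
  (\forall t \near K, 0 <= f t) -> f @ K --> v ->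
  (risk_curve phi (f t))%:E @[t --> K] --> (risk_curve phi v)%:E.
Proof.
move=> p0 v0 pa f0 fv; apply: cvg_EFin; first exact: nearW.
have /= := cvg_comp f (fun v => risk_curve phi `|v|) fv.
rewrite -{1}(ger0_norm v0) in pa.
move=> /(_ _ (risk_curve_continuous p0 pa)); rewrite ger0_norm//.
apply: cvg_trans; apply: near_eq_cvg; near=> t => /=.
by rewrite ger0_norm//; near: t.
Unshelve. all: by end_near. Qed.

Lemma inv1D_cvg0 (C : R) : 0 < C -> (1 + v * C)^-1 @[v --> +oo] --> (0 : R).
Proof.
move=> C0; apply/gtr0_cvgV0.
  by near=> v; rewrite ltr_pwDl// mulr_ge0// ltW.
apply/cvgryPge => M; near=> v.
rewrite (le_trans (ler_norm _))// -lerBlDl.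
apply: (@le_trans _ _ `|M|); first by rewrite lerBlDr lerDl.
rewrite -ler_pdivrMr//; near: v; apply: nbhs_pinfty_ge; exact: num_real.
Unshelve. all: by end_near. Qed.

Lemma dof2_le1 v : 0 <= v -> dof2 H v <= 1 - (1 + v * B)^-1.
Proof.
move=> v0; have [_ xB xB1 _] := resolvent_facts A_gt0 v0 AB.
apply: le_trans (dof2_le A_gt0 HAB v0) _.
rewrite ler_piMr//; last by rewrite ltW// (dof1_lt1 A_gt0 AB HAB).
by rewrite subr_ge0.
Qed.

Lemma dof2_cvg1 : dof2 H v @[v --> +oo] --> (1 : R).
Proof.
have cA : (1 - (1 + v * A)^-1) ^+ 2 @[v --> +oo] --> (1 : R).
  have c1 : 1 - (1 + v * A)^-1 @[v --> +oo] --> (1 : R).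
    rewrite -[X in _ --> X]subr0.
    by apply: cvgB; [exact: cvg_cst|exact: inv1D_cvg0].
  by rewrite -[X in _ --> X](expr1n _ 2); apply: cvgM.
apply: squeeze_cvgr cA (@cvg_cst _ _ _ _ _); near=> v.
have v0 : 0 <= v by near: v; apply: nbhs_pinfty_ge; exact: num_real.
rewrite (dof2_ge A_gt0 HAB v0)/= (le_trans (dof2_le1 v0))//.
by rewrite lerBlDr lerDl invr_ge0 addr_ge0// mulr_ge0// ltW.
Unshelve. all: by end_near. Qed.

Lemma mean12_cvg0 : mean12 G v @[v --> +oo] --> (0 : R).
Proof.
apply: (@squeeze_cvgr _ _ _ _ (fun=> 0) (fun v => (1 + v * A)^-1)).
- near=> v.
  have v0 : 0 < v by near: v; apply: nbhs_pinfty_gt; exact: num_real.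
  have v1 : 1 <= v by near: v; apply: nbhs_pinfty_ge; exact: num_real.
  rewrite (mean12_ge0 A_gt0 GAB (ltW v0))/=.
  apply: le_trans (mean12_le A_gt0 GAB v0) _.
  rewrite ler_piMl ?invf_le1//.
  by rewrite invr_ge0 addr_ge0// mulr_ge0// ltW.
- exact: cvg_cst.
- exact: inv1D_cvg0.
Unshelve. all: by end_near. Qed.

(** For [phi < 1] the denominator tends to [1 - phi > 0]. At [phi = 1] it tends to 0: without noise
    the numerator decays faster and the limit is 0, with noise the limit is [+oo]. *)
Lemma risk_curve_is_cvg phi : 0 < phi -> phi <= 1 ->
  cvg ((risk_curve phi v)%:E @[v --> +oo]).
Proof.
move=> p0; rewrite le_eqVlt => /predU1P[->|p1]; last first.
  apply/cvg_ex; exists ((rho2 * 0 + sigma2 * (phi * 1)) / (1 - phi * 1))%:E.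
  apply: cvg_EFin; first exact: nearW.
  have pb : phi * dof2 H v @[v --> +oo] --> phi * 1.
    by apply: cvgM; [exact: cvg_cst|exact: dof2_cvg1].
  apply: cvgM.
    apply: cvgD; apply: cvgM => //; try exact: cvg_cst.
    exact: mean12_cvg0.
  apply: cvgV; first by rewrite gt_eqF// mulr1 subr_gt0.
  by apply: cvgB => //; exact: cvg_cst.
have inv_gt0 v : 0 <= v -> 0 < (1 + v * B)^-1.
  by move=> v0; have [] := resolvent_facts A_gt0 v0 AB.
have b1 v : 0 <= v -> (1 + v * B)^-1 <= 1 - dof2 H v.
  by move=> v0; have := dof2_le1 v0; lra.
have b1_gt0 v : 0 <= v -> 0 < 1 - dof2 H v.
  by move=> v0; exact: lt_le_trans (inv_gt0 v v0) (b1 v v0).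
have invb v : 0 <= v -> (1 - dof2 H v)^-1 <= 1 + v * B.
  by move=> v0; rewrite -[leRHS]invrK lef_pV2 ?posrE ?b1_gt0 ?inv_gt0 ?b1.
apply/cvg_ex; have [s0|s0] := eqVneq sigma2 0.
  exists 0%:E; apply: cvg_EFin; first exact: nearW.
  (* The constant [B / A + 1] bounds [(1 + v * B) / (1 + v * A)], and [v^-1 <= 2 / (1 + v)] once
     [v >= 1]. *)
  apply: (@squeeze_cvgr _ _ _ _ (fun=> 0)
    (fun v => (rho2 * (B / A + 1)) * (1 + v * 1)^-1 * 2)).
  - near=> v.
    have v0 : 0 < v by near: v; apply: nbhs_pinfty_gt; exact: num_real.
    have v1 : 1 <= v by near: v; apply: nbhs_pinfty_ge; exact: num_real.
    rewrite /= risk_curve_ge0 ?(ltW v0)//=; last first.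
      by rewrite mul1r ltW// (dof1_lt1 A_gt0 AB HAB)// ltW.
    rewrite /risk_curve s0 mul0r addr0 !mul1r -mulrA -[leRHS]mulrA -mulrA.
    rewrite ler_wpM2l//.
    apply: (@le_trans _ _ (v^-1 * (1 + v * A)^-1 * (1 + v * B))).
      apply: ler_pM; rewrite ?(mean12_ge0 A_gt0 GAB) ?(ltW v0)//.
      + by rewrite invr_ge0 ltW// b1_gt0// ltW.
      + exact: (mean12_le A_gt0 GAB).
      + by rewrite invb// ltW.
    rewrite mulr1 -mulrA mulrC; apply: ler_pM.
    + by rewrite mulr_ge0 ?invr_ge0 ?addr_ge0 ?mulr_ge0// ?ltW.
    + by rewrite invr_ge0 ltW.
    + rewrite mulrC ler_pdivrMr; last by rewrite ltr_pwDl// mulr_ge0// ltW.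
      rewrite (_ : (B / A + 1) * _ = B / A + v * B + 1 + v * A); last first.
        by field; rewrite gt_eqF.
      have : 0 <= B / A by rewrite divr_ge0// ltW.
      have : 0 <= v * A by rewrite mulr_ge0// ltW.
      lra.
    + rewrite -lef_pV2 ?posrE ?mulr_gt0 ?invr_gt0 ?addr_gt0// invrK invfM invrK.
      lra.
  - exact: cvg_cst.
  - rewrite (_ : 0 = (rho2 * (B / A + 1)) * 0 * 2 :> R); last by rewrite mulr0 mul0r.
    apply: cvgM; last exact: cvg_cst.
    by apply: cvgM; [exact: cvg_cst|exact: inv1D_cvg0].
have s_gt0 : 0 < sigma2 by rewrite lt_neqAle eq_sym s0.
exists +oo%E; apply/cvgeryP/cvgryPge => M.
have : (1 - dof2 H v)^-1 @[v --> +oo] --> +oo.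
  apply/cvgrVy.
    near=> v; apply: b1_gt0.
    by near: v; apply: nbhs_pinfty_ge; exact: num_real.
  rewrite -(subrr (1 : R)); apply: cvgB; first exact: cvg_cst.
  exact: dof2_cvg1.
(* The noise term equals [sigma2 * ((1 - dof2 H v)^-1 - 1)], hence this threshold for exceeding
   [M]. *)
move=> /cvgryPge /(_ (M / sigma2 + 1)) h; near=> v.
have v0 : 0 <= v by near: v; apply: nbhs_pinfty_ge; exact: num_real.
have : M / sigma2 + 1 <= (1 - dof2 H v)^-1 by near: v.
rewrite -lerBrDr ler_pdivrMr// => /le_trans; apply.
have bn := b1_gt0 v v0.
rewrite /risk_curve !mul1r [leRHS]mulrDl.
have -> : ((1 - dof2 H v)^-1 - 1) * sigma2 = sigma2 * dof2 H v / (1 - dof2 H v).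
  by field; rewrite gt_eqF.
by rewrite lerDr mulr_ge0 ?invr_ge0 ?(ltW bn)// mulr_ge0// (mean12_ge0 A_gt0 GAB).
Unshelve. all: by end_near. Qed.

End RiskCurve.

(** * Existence, uniqueness and limits of the fixed point *)

Section FixedPoint.
Context {R : realType} (H : probability R R).
Context (A B : R) (A_gt0 : 0 < A) (AB : A <= B).
Hypothesis HAB : H `[A, B]%classic = 1%E.
Implicit Types (l s v w : R).

Let dof1_ltW v w (v0 : 0 <= v) (vw : v <= w) := dof1_le_mono A_gt0 AB HAB v0 vw.
Let dof1_strict v w (v0 : 0 <= v) (vw : v < w) := dof1_lt A_gt0 AB HAB v0 vw.

(** A comparison principle: the left side of the fixed-point equation is nondecreasing, so
    evaluating it at a trial point locates the root. *)
Lemma fixed_point_eq_lt l s v w : 0 <= l -> 0 < s -> 0 <= v -> 0 <= w ->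
  l * v + s * dof1 H v < l * w + s * dof1 H w -> v < w.
Proof.
move=> l0 s0 v0 w0; rewrite !ltNge; apply: contra => wv.
by rewrite lerD ?ler_wpM2l ?(ltW s0) ?(dof1_ltW w0).
Qed.

(** Strictness comes from [dof1], so the case [l = 0] is covered. *)
Lemma fixed_point_eq_inj l s v w : 0 <= l -> 0 < s -> 0 <= v -> 0 <= w ->
  l * v + s * dof1 H v = l * w + s * dof1 H w -> v = w.
Proof.
move=> l0 s0; wlog vw : v w / v <= w.
  move=> wl v0 w0 e; have [vw|/ltW wv] := leP v w; first exact: wl.
  by apply/esym/wl.
move=> v0 w0 e; apply/eqP; rewrite eq_le vw leNgt; apply/negP => vw'.
have : l * v + s * dof1 H v < l * w + s * dof1 H w.
  by rewrite ler_ltD// ?ler_wpM2l// ltr_pM2l// dof1_strict.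
by rewrite e ltxx.
Qed.

Lemma fixed_point_eq_ex l s M : 0 <= l -> 0 < s -> 0 <= M ->
  1 <= l * M + s * dof1 H M ->
  exists v, 0 < v /\ l * v + s * dof1 H v = 1.
Proof.
move=> l0 s0 M0 M1; pose f v := l * v + s * dof1 H `|v|.
have cf : continuous f.
  move=> v; apply: cvgD; first by apply: cvgM => //; exact: cvg_cst.
  by apply: cvgM; [exact: cvg_cst|exact: (dof1_continuous A_gt0 HAB)].
have f0 : f 0 = 0 by rewrite /f normr0 dof1_0 !mulr0 addr0.
have fM : 1 <= f M by rewrite /f ger0_norm.
have [|v] := @IVT R f 0 M 1 M0 (continuous_subspaceT cf).
  rewrite f0 ge_min ler01/= le_max fM orbT//.
rewrite in_itv/= => /andP[v0 _] fv; exists v.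
have vn : v != 0 by apply: contra_eq_neq fv => ->; rewrite f0 eq_sym oner_eq0.
by rewrite lt_neqAle eq_sym vn v0; split => //; rewrite -fv /f ger0_norm.
Qed.

Lemma fixed_pointP l s : 0 < l -> 0 < s ->
  0 < fixed_point H l s /\
  l * fixed_point H l s + s * dof1 H (fixed_point H l s) = 1.
Proof.
move=> l0 s0.
have equiv v : 0 < v ->
    v^-1 = l + s * mean1 H v <-> l * v + s * dof1 H v = 1.
  move=> v0; rewrite /dof1 mulrCA [l * v]mulrC -mulrDr; split => [<-|e].
    by rewrite divff ?gt_eqF.
  by apply: (mulfI (lt0r_neq0 v0)); rewrite e divff ?gt_eqF.
(* At [l^-1] the term [l * v] alone already reaches 1. *)
have [||v [v0 ve]] := @fixed_point_eq_ex l s l^-1 (ltW l0) s0.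
- by rewrite invr_ge0 ltW.
- rewrite divff ?gt_eqF// lerDl mulr_ge0 ?(ltW s0)//.
  by rewrite (dof1_ge0 A_gt0 HAB)// invr_ge0 ltW.
rewrite /fixed_point; case: xgetP => [w _ [w0 /(equiv w w0)]//|].
by move=> /(_ v) []; split => //; exact/equiv.
Qed.

Lemma fixed_point_unique l s v : 0 < l -> 0 < s -> 0 < v ->
  l * v + s * dof1 H v = 1 -> fixed_point H l s = v.
Proof.
move=> l0 s0 v0 ve; have [w0 we] := fixed_pointP l0 s0.
by apply: (@fixed_point_eq_inj l s); rewrite ?we ?ve ?ltW.
Qed.

Lemma fixed_point_le l s : 0 < l -> 0 < s -> fixed_point H l s <= l^-1.
Proof.
move=> l0 s0; have [w0 we] := fixed_pointP l0 s0.
rewrite -(ler_pM2l l0) divff ?gt_eqF// -we lerDl mulr_ge0 ?(ltW s0)//.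
by rewrite (dof1_ge0 A_gt0 HAB) ?ltW.
Qed.

Lemma fixed_point_gt l s M : 0 < l -> 0 < s -> 0 <= M ->
  l * M + s * dof1 H M < 1 -> M < fixed_point H l s.
Proof.
move=> l0 s0 M0 lM; have [w0 we] := fixed_pointP l0 s0.
by apply: (@fixed_point_eq_lt l s); rewrite ?we ?(ltW l0) ?(ltW w0).
Qed.

Lemma dof1_cvg1 : dof1 H v @[v --> +oo] --> (1 : R).
Proof.
have c1 : 1 - (1 + v * A)^-1 @[v --> +oo] --> (1 : R).
  rewrite -[X in _ --> X]subr0.
  by apply: cvgB; [exact: cvg_cst|exact: inv1D_cvg0].
apply: squeeze_cvgr c1 (@cvg_cst _ _ _ _ _); near=> v.
have v0 : 0 <= v by near: v; apply: nbhs_pinfty_ge; exact: num_real.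
by rewrite (dof1_ge A_gt0 HAB v0)/= ltW// (dof1_lt1 A_gt0 AB HAB).
Unshelve. all: by end_near. Qed.

Lemma ridgeless_fixed_point_ex s : 1 < s ->
  exists v, 0 < v /\ s * dof1 H v = 1.
Proof.
move=> s1; have s0 : 0 < s by exact: lt_trans s1.
have near_ge : \forall v \near +oo, s^-1 <= dof1 H v.
  by apply: (cvgr_ge _ dof1_cvg1); rewrite invf_lt1.
near (pinfty_nbhs R) => M.
have M0 : 0 <= M by near: M; apply: nbhs_pinfty_ge; exact: num_real.
have [|v [v0]] := @fixed_point_eq_ex 0 s M (lexx 0) s0 M0.
  rewrite mul0r add0r mulrC -ler_pdivrMr// mul1r.
  by near: M.
by rewrite mul0r add0r; exists v.
Unshelve. all: by end_near. Qed.

(** A positive penalty pushes the root below [v], while at [v - e] the equation has a deficit [gap]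
    that a small [l] cannot fill. *)
Lemma fixed_point_cvg_ridgeless s v : 0 < s -> 0 < v -> s * dof1 H v = 1 ->
  fixed_point H l s @[l --> 0^'+] --> v.
Proof.
move=> s0 v0 ve; apply/cvgrPdist_le => e e0.
have below l : 0 < l -> fixed_point H l s < v.
  move=> l0; have [w0 we] := fixed_pointP l0 s0.
  apply: (@fixed_point_eq_lt l s); rewrite ?(ltW l0) ?(ltW w0) ?(ltW v0)// we ve.
  by rewrite ltrDr mulr_gt0.
(* If [v <= e], positivity of the fixed point suffices; otherwise [v - e] is a legitimate trial
   point. *)
have [ev|ev] := leP v e.
  near=> l; have l0 : 0 < l by near: l; exact: nbhs_right_gt.
  have [w0 _] := fixed_pointP l0 s0.
  rewrite ger0_norm ?subr_ge0 ?(ltW (below l l0))// (le_trans _ ev)//.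
  by rewrite lerBlDr lerDl ltW.
have ve0 : 0 < v - e by rewrite subr_gt0.
have gap : 0 < 1 - s * dof1 H (v - e).
  by rewrite subr_gt0 -ve ltr_pM2l// dof1_strict ?(ltW ve0)// ltrBlDr ltrDl.
near=> l; have l0 : 0 < l by near: l; exact: nbhs_right_gt.
rewrite ger0_norm ?subr_ge0 ?(ltW (below l l0))//.
rewrite lerBlDr -lerBlDl ltW//; apply: fixed_point_gt => //; first exact: ltW.
rewrite -ltrBrDr -ltr_pdivlMr//; near: l; apply: nbhs_right_lt.
by rewrite divr_gt0.
Unshelve. all: by end_near. Qed.

(** Here [s * dof1 H v < 1] for every [v >= 0], so as [l] tends to 0 the root passes any level. *)
Lemma fixed_point_cvg_pinfty s : 0 < s -> s <= 1 ->
  fixed_point H l s @[l --> 0^'+] --> +oo.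
Proof.
move=> s0 s1; apply/cvgryPge => M.
have M0 : 0 < `|M| + 1 by rewrite ltr_wpDl.
have gap : 0 < 1 - s * dof1 H (`|M| + 1).
  by rewrite subr_gt0 (phi_dof1_lt1 A_gt0 AB HAB)// ltW.
near=> l; have l0 : 0 < l by near: l; exact: nbhs_right_gt.
rewrite (le_trans (ler_norm _))// (@le_trans _ _ (`|M| + 1)) ?lerDl//.
rewrite ltW//; apply: fixed_point_gt => //.
rewrite -ltrBrDr -ltr_pdivlMr//; near: l; apply: nbhs_right_lt.
by rewrite divr_gt0.
Unshelve. all: by end_near. Qed.

Lemma fixed_point_cvg0 s : 0 < s -> fixed_point H l s @[l --> +oo] --> (0 : R).
Proof.
move=> s0; apply: (@squeeze_cvgr _ _ _ _ (fun=> 0) (fun l => l^-1)).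
- near=> l; have l0 : 0 < l by near: l; apply: nbhs_pinfty_gt; exact: num_real.
  by have [/ltW -> _] := fixed_pointP l0 s0; exact: fixed_point_le.
- exact: cvg_cst.
- apply/gtr0_cvgV0; last exact: cvg_id.
  by near=> l; near: l; apply: nbhs_pinfty_gt; exact: num_real.
Unshelve. all: by end_near. Qed.

Lemma ridgeless_fixed_point_lt s v e : 0 <= v -> 0 < e -> s * dof1 H v = 1 ->
  (dof1 H e)^-1 < s -> v < e.
Proof.
move=> v0 e0 ve es.
have ae : 0 < dof1 H e by rewrite -(dof1_0 H) dof1_strict.
have s0 : 0 < s by apply: lt_trans es; rewrite invr_gt0.
rewrite ltNge; apply/negP => /(dof1_ltW (ltW e0)).
rewrite -(ler_pM2l s0) ve leNgt => /negP; apply.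
by rewrite mulrC -ltr_pdivrMl// mulr1.
Qed.

End FixedPoint.

(** * The common set of risk values, its minimum and its monotonicity in [phi] *)

Section RiskSets.
Context {R : realType} (H G : probability R R) (rho2 sigma2 : R).
Context (A B : R) (A_gt0 : 0 < A) (AB : A <= B).
Hypotheses (HAB : H `[A, B]%classic = 1%E) (GAB : G `[A, B]%classic = 1%E).
Hypotheses (rho2_ge0 : 0 <= rho2) (sigma2_ge0 : 0 <= sigma2).
Implicit Types (l phi s v w : R).

Notation F := (risk_curve H G rho2 sigma2).
Notation Foo := (risk_at_infinity H G rho2 sigma2).

Definition risk_values phi : set (\bar R) :=
  [set x | (exists v, [/\ 0 <= v, phi * dof1 H v <= 1 & x = (F phi v)%:E]) \/
           (phi <= 1 /\ x = Foo phi)].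

(** Multiplying through by [v ^+ 2] gives [1 + v_tilde = (1 - phi * dof2 H v)^-1]; [phi <= s] and
    the fixed-point equation ensure that this denominator is positive. *)
Lemma finite_riskE l phi s : 0 < l -> 0 < phi -> phi <= s ->
  finite_risk H G rho2 sigma2 l phi s = F phi (fixed_point H l s).
Proof.
move=> l0 p0 ps; have s0 : 0 < s by exact: lt_le_trans ps.
have [v0 ve] := fixed_pointP A_gt0 HAB l0 s0.
set v := fixed_point H l s in v0 ve *.
have a0 : 0 <= dof1 H v by rewrite (dof1_ge0 A_gt0 HAB)// ltW.
have pa : phi * dof1 H v <= 1.
  apply: (@le_trans _ _ (s * dof1 H v)); first by rewrite ler_wpM2r.
  by rewrite -ve lerDr mulr_ge0 ?ltW.
have pb := phi_dof2_lt1 A_gt0 AB HAB p0 (ltW v0) pa.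
rewrite /finite_risk /c_tilde /v_tilde -/v -/(mean2 H v) -/(mean12 G v).
rewrite /risk_curve; move: pb; rewrite /dof2.
move: (mean2 H v) (mean12 G v) => I q pb.
clearbody v; clear ve a0 pa. 
have d1 : 1 - phi * (v ^+ 2 * I) != 0 by rewrite gt_eqF// subr_gt0.
have d2 : v ^- 2 - phi * I != 0.
  apply: contra_neq d1 => e.
  have -> : 1 - phi * (v ^+ 2 * I) = v ^+ 2 * (v ^- 2 - phi * I).
    by field; rewrite gt_eqF.
  by rewrite e mulr0.
have -> : phi * I / (v ^- 2 - phi * I) =
    phi * (v ^+ 2 * I) / (1 - phi * (v ^+ 2 * I)).
  have e : v ^- 2 - phi * I = (1 - phi * (v ^+ 2 * I)) / v ^+ 2.
    by field; rewrite gt_eqF.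
  rewrite e invf_div; field.
  by rewrite d1.
by field.
Qed.

Lemma phi_dof1_fixed_point l phi s : 0 < l -> 0 < phi -> phi <= s ->
  phi * dof1 H (fixed_point H l s) < 1.
Proof.
move=> l0 p0 ps; have s0 : 0 < s by exact: lt_le_trans ps.
have [v0 ve] := fixed_pointP A_gt0 HAB l0 s0.
apply: (@le_lt_trans _ _ (s * dof1 H (fixed_point H l s))).
  by rewrite ler_wpM2r// (dof1_ge0 A_gt0 HAB)// ltW.
by rewrite -ve ltrDr mulr_gt0.
Qed.

Lemma near_fixed_point_ge0 s : 0 < s ->
  \forall l \near 0^'+, 0 <= fixed_point H l s.
Proof.
move=> s0; near=> l; apply: ltW.
apply: (fixed_pointP A_gt0 HAB _ s0).1.
by near: l; exact: nbhs_right_gt.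
Unshelve. all: by end_near. Qed.

Lemma lim_finite_risk0 phi s (x : \bar R) : 0 < phi -> phi <= s ->
  (F phi (fixed_point H l s))%:E @[l --> 0^'+] --> x ->
  lim ((finite_risk H G rho2 sigma2 l phi s)%:E @[l --> 0^'+]) = x.
Proof.
move=> p0 ps cx; apply/cvg_lim => //.
apply: cvg_trans cx; apply: near_eq_cvg; near=> l.
by rewrite finite_riskE//; near: l; exact: nbhs_right_gt.
Unshelve. all: by end_near. Qed.

Lemma risk0_gt1 phi s v : 0 < phi -> phi <= s -> 0 < v -> s * dof1 H v = 1 ->
  risk_finite_psi H G rho2 sigma2 0%:E phi s = (F phi v)%:E.
Proof.
move=> p0 ps v0 ve; rewrite /= ltxx.
have s0 : 0 < s by exact: lt_le_trans ps.
apply: lim_finite_risk0 => //.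
apply: (risk_curve_cvg A_gt0 AB HAB GAB) => //.
- exact: ltW.
- by rewrite -ve ler_wpM2r// (dof1_ge0 A_gt0 HAB)// ltW.
- exact: near_fixed_point_ge0.
- exact: (fixed_point_cvg_ridgeless A_gt0 AB HAB).
Qed.

(** The fixed point diverges as the penalty vanishes, so all these [s] share the limit of the curve
    at infinity. *)
Lemma risk0_le1 phi s : 0 < phi -> phi <= s -> s <= 1 ->
  risk_finite_psi H G rho2 sigma2 0%:E phi s = Foo phi.
Proof.
move=> p0 ps s1; rewrite /= ltxx.
have s0 : 0 < s by exact: lt_le_trans ps.
apply: lim_finite_risk0 => //.
apply: (cvg_comp (fun l => fixed_point H l s) (fun v => (F phi v)%:E)).
  exact: (fixed_point_cvg_pinfty A_gt0 AB HAB).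
apply: (risk_curve_is_cvg A_gt0 AB HAB GAB) => //.
exact: le_trans s1.
Qed.

Lemma risk_pinfty_lam phi : 0 < phi ->
  risk_finite_psi H G rho2 sigma2 +oo%E phi phi = (F phi 0)%:E.
Proof.
move=> p0; apply/cvg_lim => //.
have : (F phi (fixed_point H l phi))%:E @[l --> +oo] --> (F phi 0)%:E.
  apply: (risk_curve_cvg A_gt0 AB HAB GAB) => //.
  - by rewrite dof1_0 mulr0.
  - near=> l; apply: ltW; apply: (fixed_pointP A_gt0 HAB _ p0).1.
    by near: l; apply: nbhs_pinfty_gt; exact: num_real.
  - exact: (fixed_point_cvg0 A_gt0 HAB).
apply: cvg_trans; apply: near_eq_cvg; near=> l.
rewrite finite_riskE//; near: l; apply: nbhs_pinfty_gt; exact: num_real.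
Unshelve. all: by end_near. Qed.

Lemma risk_pinfty_psi phi : 0 < phi ->
  lim (risk_finite_psi H G rho2 sigma2 0%E phi s @[s --> +oo]) = (F phi 0)%:E.
Proof.
move=> p0; apply/cvg_lim => //.
(* Putting [1 < s] under the quantifier lets a root be chosen as a total function of [s]; its values
   for [s <= 1] are irrelevant to the limit. *)
have ex s : exists v, 1 < s -> 0 < v /\ s * dof1 H v = 1.
  have [/(ridgeless_fixed_point_ex A_gt0 AB HAB)[v vP]|_] := boolP (1 < s).
    by exists v.
  by exists 0.
have [v vP] := choice ex.
have : (F phi (v s))%:E @[s --> +oo] --> (F phi 0)%:E.
  apply: (risk_curve_cvg A_gt0 AB HAB GAB) => //.
  - by rewrite dof1_0 mulr0.
  - near=> s; apply/ltW/(vP s _).1.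
    by near: s; apply: nbhs_pinfty_gt; exact: num_real.
  - apply/cvgr0Pnorm_le => e e0; near=> s.
    have [|v0 ve] := vP s.
      by near: s; apply: nbhs_pinfty_gt; exact: num_real.
    rewrite gtr0_norm// ltW//.
    apply: (ridgeless_fixed_point_lt A_gt0 AB HAB (ltW v0) e0 ve).
    by near: s; apply: nbhs_pinfty_gt; exact: num_real.
apply: cvg_trans; apply: near_eq_cvg; near=> s.
have [|v0 ve] := vP s.
  by near: s; apply: nbhs_pinfty_gt; exact: num_real.
rewrite (@risk0_gt1 _ _ (v s))//.
Unshelve. all: by end_near. Qed.

Lemma ridgeless_risksE phi : 0 < phi ->
  ridgeless_risks H G rho2 sigma2 phi = risk_values phi.
Proof.
move=> p0; apply/seteqP; split => [x [[s| |] /=]|x].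
- rewrite lee_fin => ps <-; have [s1|s1] := leP s 1.
    by right; split; [exact: le_trans s1|exact: risk0_le1].
  have [v [v0 ve]] := ridgeless_fixed_point_ex A_gt0 AB HAB s1.
  left; exists v; split; [exact: ltW| |exact: risk0_gt1].
  by rewrite -ve ler_wpM2r// (dof1_ge0 A_gt0 HAB)// ltW.
- move=> _ <-; left; exists 0; split => //; first by rewrite dof1_0 mulr0.
  exact: risk_pinfty_psi.
- by rewrite leeNy_eq.
- move=> [[v [v0 pa ->]]|[p1 ->]]; last first.
    by exists phi%:E => //=; exact: risk0_le1.
  have [->|vn] := eqVneq v 0.
    by exists +oo%E; [exact: leey|exact: risk_pinfty_psi].
  have {vn}v0 : 0 < v by rewrite lt_neqAle eq_sym vn.
  have a0 : 0 < dof1 H v.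
    by rewrite -(dof1_0 H) (dof1_lt A_gt0 AB HAB).
  (* The ratio [psi] whose ridgeless root is [v] is [(dof1 H v)^-1]; it is admissible exactly
     because [phi * dof1 H v <= 1]. *)
  have ps : phi <= (dof1 H v)^-1 by rewrite -[leRHS]mul1r ler_pdivlMr.
  exists (dof1 H v)^-1%:E; first by rewrite /= lee_fin.
  by apply: risk0_gt1 => //; rewrite mulVf// gt_eqF.
Qed.

Lemma ridge_risksE phi : 0 < phi ->
  ridge_risks H G rho2 sigma2 phi = risk_values phi.
Proof.
move=> p0; apply/seteqP; split => [x [[l| |] /=]|x].
- rewrite lee_fin le_eqVlt => /predU1P[<-|l0] <-.
    have [p1|p1] := leP phi 1.
      by right; split => //; exact: risk0_le1.
    have [v [v0 ve]] := ridgeless_fixed_point_ex A_gt0 AB HAB p1.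
    by left; exists v; split; [exact: ltW|rewrite ve|exact: risk0_gt1].
  rewrite l0 finite_riskE//; left; exists (fixed_point H l phi); split => //.
    by rewrite ltW// (fixed_pointP A_gt0 HAB l0 p0).1.
  by rewrite ltW// phi_dof1_fixed_point.
- move=> _ <-; left; exists 0; split => //; first by rewrite dof1_0 mulr0.
  exact: risk_pinfty_lam.
- by rewrite leeNy_eq.
- move=> [[v [v0 pa ->]]|[p1 ->]]; last first.
    by exists 0%E => //=; exact: risk0_le1.
  have [->|vn] := eqVneq v 0.
    by exists +oo%E; [exact: leey|exact: risk_pinfty_lam].
  have {vn}v0 : 0 < v by rewrite lt_neqAle eq_sym vn.
  move: pa; rewrite le_eqVlt => /predU1P[pa|pa].
    by exists 0%E => //=; exact: risk0_gt1.
  (* The penalty that solves the fixed-point equation for the given [v]; the boundary case of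
     penalty 0 has just been settled. *)
  have l0 : 0 < (1 - phi * dof1 H v) / v by rewrite divr_gt0// subr_gt0.
  exists ((1 - phi * dof1 H v) / v)%:E; first by rewrite /= lee_fin ltW.
  rewrite /= l0 finite_riskE// (@fixed_point_unique _ H _ _ A_gt0 AB HAB _ _ v)//.
  by rewrite divfK ?gt_eqF// subrK.
Qed.

(** For [phi > 1] the admissible [v] form a compact interval. For [phi <= 1] either no [v] beats the
    limit at infinity, which is then the minimum, or some [w] does, and the search reduces to a
    compact interval containing [w]. *)
Lemma risk_values_min phi : 0 < phi ->
  exists2 x, risk_values phi x & lbound (risk_values phi) x.
Proof.
move=> p0.
have seg M : 0 <= M -> (forall v, 0 <= v -> v <= M -> phi * dof1 H v <= 1) ->
    exists c, [/\ 0 <= c, c <= M & forall v, 0 <= v -> v <= M -> F phi c <= F phi v].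
  move=> M0 Ma; have cF : {within `[0, M], continuous (fun v => F phi `|v|)}.
    apply: continuous_in_subspaceT => v; rewrite inE/= in_itv/= => /andP[v0 vM].
    apply: (risk_curve_continuous A_gt0 AB HAB GAB) => //.
    by rewrite ger0_norm// Ma.
  have [c] := EVT_min M0 cF; rewrite in_itv/= => /andP[c0 cM] cmin.
  exists c; split => // v v0 vM.
  by have := cmin v; rewrite in_itv/= v0 vM !ger0_norm//; exact.
have [p1|p1] := leP phi 1; last first.
  have [V [V0 Ve]] := ridgeless_fixed_point_ex A_gt0 AB HAB p1.
  have VP v : 0 <= v -> v <= V -> phi * dof1 H v <= 1.
    move=> v0 vV; rewrite -Ve ler_pM2l//.
    exact: (dof1_le_mono A_gt0 AB HAB).
  have [c [c0 cV cmin]] := seg V (ltW V0) VP.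
  exists (F phi c)%:E; first by left; exists c; split => //; exact: VP.
  move=> y [[v [v0 pa ->]]|[]]; last by rewrite leNgt p1.
  rewrite lee_fin; apply: cmin => //.
  rewrite leNgt; apply/negP => /(dof1_lt A_gt0 AB HAB (ltW V0)).
  by rewrite -(ltr_pM2l p0) Ve ltNge pa.
have pa v : 0 <= v -> phi * dof1 H v <= 1.
  by move=> v0; rewrite ltW// (phi_dof1_lt1 A_gt0 AB HAB).
have cvgF := risk_curve_is_cvg A_gt0 AB HAB GAB rho2_ge0 sigma2_ge0 p0 p1.
have [[w w0 wlt]|nlt] := pselect (exists2 w, 0 <= w & ((F phi w)%:E < Foo phi)%E).
  have [M [M0 MP]] : exists M, 0 <= M /\
      forall v, M <= v -> ((F phi w)%:E < (F phi v)%:E)%E.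
    have [M [Mr MP]] : \forall v \near +oo, ((F phi w)%:E < (F phi v)%:E)%E.
      exact: cvgF _ (open_ereal_gt' wlt).
    exists (`|M| + 1); split => [|v Mv]; first by rewrite addr_ge0.
    apply: MP; rewrite (le_lt_trans (ler_norm _))// (lt_le_trans _ Mv)//.
    by rewrite ltrDl.
  have [c [c0 cM cmin]] := seg M M0 (fun u u0 _ => pa u u0).
  (* Past [M] the curve lies strictly above its value at [w], so [w] itself cannot lie there. *)
  have wM : w <= M by rewrite leNgt; apply/negP => /ltW /MP; rewrite ltxx.
  exists (F phi c)%:E; first by left; exists c; split => //; exact: pa.
  have cw := cmin w w0 wM.
  move=> y [[v [v0 _ ->]]|[_ ->]].
    have [vM|/ltW /MP] := leP v M; first by rewrite lee_fin cmin.
    by rewrite lte_fin lee_fin => /ltW; exact: le_trans.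
  by rewrite (le_trans _ (ltW wlt))// lee_fin.
exists (Foo phi); first by right.
move=> y [[v [v0 _ ->]]|[_ ->//]].
by rewrite leNgt; apply/negP => vlt; apply: nlt; exists v.
Qed.

Lemma risk_values_inf phi : 0 < phi ->
  risk_values phi (ereal_inf (risk_values phi)).
Proof.
move=> p0; have [x vx lx] := risk_values_min p0.
suff -> : ereal_inf (risk_values phi) = x by [].
apply/eqP; rewrite eq_le ereal_inf_lbound//=.
exact: le_ereal_inf_tmp.
Qed.

Lemma risk_values_inf_mono phi1 phi2 : 0 < phi1 -> phi1 <= phi2 ->
  (ereal_inf (risk_values phi1) <= ereal_inf (risk_values phi2))%E.
Proof.
move=> p1 p12; have p2 : 0 < phi2 by exact: lt_le_trans p12.
have pa v : 0 <= v -> phi2 * dof1 H v <= 1 -> phi1 * dof1 H v <= 1.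
  move=> v0; apply: le_trans; rewrite ler_wpM2r//.
  exact: (dof1_ge0 A_gt0 HAB).
apply: le_ereal_inf_tmp => y [[v [v0 pa2 ->]]|[p21 ->]].
  apply: (@le_trans _ _ (F phi1 v)%:E).
    by apply: ereal_inf_lbound; left; exists v; split => //; exact: pa.
  rewrite lee_fin; exact: (risk_curve_mono A_gt0 AB HAB GAB).
(* The point at infinity, admissible for [phi2], is so for [phi1]; the pointwise comparison passes
   to the limit. *)
have p11 : phi1 <= 1 by exact: le_trans p21.
apply: (@le_trans _ _ (Foo phi1)).
  by apply: ereal_inf_lbound; right.
apply: lee_lim.
- exact: (risk_curve_is_cvg A_gt0 AB HAB GAB).
- exact: (risk_curve_is_cvg A_gt0 AB HAB GAB).
- near=> v; rewrite lee_fin.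
  have v0 : 0 <= v by near: v; apply: nbhs_pinfty_ge; exact: num_real.
  apply: (risk_curve_mono A_gt0 AB HAB GAB) => //.
  by rewrite ltW// (phi_dof1_lt1 A_gt0 AB HAB).
Unshelve. all: by end_near. Qed.

End RiskSets.

(** * Spectra of the data *)

Section Spectrum.
Context {d : measure_display} {T : measurableType d} {R : realType}.
Context {P : probability T R} (D : ridge_data P).

(** Links the listed [eigval] to the bounds of (A2), which concern eigenvalues of the matrix.
    Eigenvectors are rows here, hence the transpose of [eigvec j] as witness. *)
Lemma eigenvalue_eigval m (j : 'I_(pp D m)) :
  eigenvalue (Sigma D m) (eigval j).
Proof.
apply/eigenvalueP; exists (eigvec j)^T.
  rewrite (Sigma_spectral D m) mulmx_sumr (bigD1 j)//= big1 => [|i ij].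
    by rewrite addr0 -scalemxAr mulmxA eigvec_orthonormal eqxx mul1mx.
  rewrite -scalemxAr mulmxA eigvec_orthonormal eq_sym (negbTE ij).
  by rewrite mul_scalar_mx scale0r scaler0.
apply/eqP => wj0; have := eigvec_orthonormal j j.
rewrite wj0 mul0mx eqxx => /matrixP/(_ 0 0)/eqP.
by rewrite !mxE/= eq_sym oner_eq0.
Qed.

Lemma eigval_bounds : assumption_A2 D -> exists rmin rmax : R, 0 < rmin /\
  forall m (j : 'I_(pp D m)), rmin <= eigval j <= rmax.
Proof.
move=> [nu [M [rmin [rmax [_ r0 _ Sr _]]]]]; exists rmin, rmax; split => // m j.
by have [_] := Sr m; apply; exact: eigenvalue_eigval.
Qed.

Lemma limits_concentrated (H G : probability R R) (rho2 sigma2 : R) :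
  assumption_A2 D -> assumption_A3 D H -> assumption_A4 D G rho2 sigma2 ->
  exists A B : R, [/\ 0 < A, A <= B, H `[A, B]%classic = 1%E &
                      G `[A, B]%classic = 1%E].
Proof.
move=> /eigval_bounds[rmin [rmax [r0 rP]]] HH [GG _ _].
have below m (j : 'I_(pp D m)) t : t < rmin -> (eigval j <= t)%R = false.
  move=> tr; have /andP[rj _] := rP m j.
  by apply/negbTE; rewrite -ltNge (lt_le_trans tr).
have above m (j : 'I_(pp D m)) t : rmax <= t -> (eigval j <= t)%R.
  by move=> rt; have /andP[_ rj] := rP m j; exact: le_trans rt.
have HAB : H `[rmin / 2, rmax + 1]%classic = 1%E.
  apply: (cvg_weakly_concentrated r0 HH) => m t tr; rewrite /spectral_dist.
    by rewrite big1 ?mulr0// => j _; rewrite below.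
  by congr (_ * _); apply: eq_bigr => j _; rewrite !above.
have GAB : G `[rmin / 2, rmax + 1]%classic = 1%E.
  apply: (cvg_weakly_concentrated r0 GG) => m t tr; rewrite /signal_dist.
    by rewrite big1 ?mulr0// => j _; rewrite below// mulr0.
  by congr (_ * _); apply: eq_bigr => j _; rewrite !above.
exists (rmin / 2), (rmax + 1); split => //; first by rewrite divr_gt0.
(* Were the interval empty, its mass would be 0 and not 1. *)
rewrite leNgt; apply/negP => AB; move: HAB.
rewrite set_itv_ge ?bnd_simp -?ltNge// measure0 => /eqP.
by rewrite eqe eq_sym oner_eq0.
Qed.

Lemma limits_ge0 (G : probability R R) (rho2 sigma2 : R) :
  assumption_A4 D G rho2 sigma2 -> 0 <= rho2 /\ 0 <= sigma2.
Proof.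
move=> [_ crho csigma]; split.
  apply: (cvgr_to_ge crho); apply: nearW => m.
  by apply: sumr_ge0 => j _; exact: sqr_ge0.
rewrite -lee_fin; apply: (cvge_to_ge csigma); apply: nearW => m.
by apply: expectation_ge0 => w; exact: sqr_ge0.
Qed.

End Spectrum.

Theorem theorem6 (d : measure_display) (T : measurableType d) (R : realType)
    (P : probability T R) (D : ridge_data P)
    (H G : probability R R) (rho2 sigma2 : R)
    (phi0 : R) (psi0 : \bar R)
    (phi0_gt0 : 0 < phi0) (phi0_le_psi0 : (phi0%:E <= psi0)%E)
    (regime : proportional_regime D phi0 psi0)
    (A1 : assumption_A1 D) (A2 : assumption_A2 D)
    (A3 : assumption_A3 D H) (A4 : assumption_A4 D G rho2 sigma2) :
  ((forall phi : R, 0 < phi ->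
      ridgeless_risks H G rho2 sigma2 phi
        (optimal_ridgeless_risk H G rho2 sigma2 phi)) /\
   (forall phi1 phi2 : R, 0 < phi1 -> phi1 <= phi2 ->
      (optimal_ridgeless_risk H G rho2 sigma2 phi1 <=
       optimal_ridgeless_risk H G rho2 sigma2 phi2)%E)) /\
  ((forall phi : R, 0 < phi ->
      ridge_risks H G rho2 sigma2 phi
        (optimal_ridge_risk H G rho2 sigma2 phi)) /\
   (forall phi1 phi2 : R, 0 < phi1 -> phi1 <= phi2 ->
      (optimal_ridge_risk H G rho2 sigma2 phi1 <=
       optimal_ridge_risk H G rho2 sigma2 phi2)%E)).
Proof.
have [A [B [A_gt0 AB HAB GAB]]] := limits_concentrated A2 A3 A4.
have [rho2_ge0 sigma2_ge0] := limits_ge0 A4.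
have attained := risk_values_inf A_gt0 AB HAB GAB rho2_ge0 sigma2_ge0.
have mono := risk_values_inf_mono A_gt0 AB HAB GAB rho2_ge0 sigma2_ge0.
(* Both problems minimise over the same [risk_values phi], so one attainment and one monotonicity
   result settle all four claims. *)
have ridgelessE := ridgeless_risksE A_gt0 AB HAB GAB rho2_ge0 sigma2_ge0.
have ridgeE := ridge_risksE A_gt0 AB HAB GAB rho2_ge0 sigma2_ge0.
rewrite /optimal_ridgeless_risk /optimal_ridge_risk.
split; split => [phi p0|phi1 phi2 p0 p12].
- by rewrite ridgelessE//; exact: attained.
- by rewrite !ridgelessE ?(lt_le_trans p0 p12)//; exact: mono.
- by rewrite ridgeE//; exact: attained.
- by rewrite !ridgeE ?(lt_le_trans p0 p12)//; exact: mono.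
Qed.
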